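(* Let $n \geq 2$ and let $\pi$ be a representation of the Cuntz algebra $\mathcal{O}_n$ on a Hilbert space $\mathcal{H}$, with $S_i = \pi(s_i)$ for $1 \leq i \leq n$, such that there is a finite-dimensional subspace $\mathcal{K} \subseteq \mathcal{H}$ satisfying $S_i^* \mathcal{K} \subseteq \mathcal{K}$ for $1 \leq i \leq n$ and \[ \mathcal{H} = \bigvee_{k \geq 1}\ \bigvee_{1 \leq i_1, \ldots, i_k \leq n} S_{i_1} \cdots S_{i_k} \mathcal{K}. \] Let $A_i = P_{\mathcal{K}} S_i|_{\mathcal{K}} = (S_i^*|_{\mathcal{K}})^* \in \mathcal{B}(\mathcal{K})$ and let $\Phi(X) = \sum_{i=1}^n A_i X A_i^*$ be the associated completely positive unital map on $\mathcal{B}(\mathcal{K})$. Then: (a) The maximal families of pairwise orthogonal minimal subspaces of $\mathcal{K}$ that are $A_i^*$-invariant for $1\le i\le n$ are exactly the families of ranges of maximal families of mutually orthogonal minimal projections $p \in \mathcal{B}(\mathcal{K})$ satisfying $p \leq \Phi(p)$; in particular these subspaces depend only on $\Phi$. (b) The representation $\pi$ is irreducible if and only if there is a unique minimal projection $p \in \mathcal{B}(\mathcal{K})$ satisfying $p \leq \Phi(p)$.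
   Context: $\mathcal{O}_n$ is the universal (unital) $\mathrm{C}^*$-algebra generated by $s_1,\dots,s_n$ subject to $s_i^* s_j = \delta_{ij} I$ for $1\le i,j\le n$ and $\sum_{i=1}^n s_i s_i^* = I$; representations are unital $*$-representations, so $S_1,\dots,S_n$ satisfy the same relations. $\bigvee$ denotes closed linear span, and $P_{\mathcal{K}}$ is the orthogonal projection of $\mathcal{H}$ onto $\mathcal{K}$. One has $\sum_i A_iA_i^* = I_{\mathcal{K}}$. ''Minimal projection satisfying $p \leq \Phi(p)$'' means a non-zero orthogonal projection $p\in\mathcal{B}(\mathcal{K})$ with $p \le \Phi(p)$ such that no non-zero projection $q \lneq p$ satisfies $q \leq \Phi(q)$ (so $p$ itself need not have rank one). ''Minimal $A_i^*$-invariant subspace'' means a non-zero subspace of $\mathcal{K}$ invariant under all of $A_1^*,\dots,A_n^*$ and properly containing no non-zero such subspace. A representation is irreducible if it has no closed reducing subspaces other than $\{0\}$ and the whole space. *)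

(* Defs.v *)
(* MathComp / MathComp-Analysis.  R : realType, and R[i] is the field of
   complex numbers. *)
From HB Require Import structures.
From mathcomp Require Export all_boot all_order all_algebra.
From mathcomp Require Export all_classical all_reals all_analysis.
From mathcomp Require Export complex.

Set Implicit Arguments.
Unset Strict Implicit.
Unset Printing Implicit Defensive.

Import Order.TTheory GRing.Theory Num.Theory.
Import numFieldNormedType.Exports.

Local Open Scope classical_set_scope.
Local Open Scope ring_scope.

(* The inner product is linear in its first argument and conjugate-linear in
   the second one. *)
HB.mixin Record CompleteNormedModule_isHilbert (R : realType) (H : Type)
    of CompleteNormedModule R[i] H := {
  hdot : {dot H for Num.conj};
  hdot_norm : forall x : H, hdot x x = `|x| ^+ 2
}.

#[short(type="hilbertType")]
HB.structure Definition Hilbert (R : realType) :=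
  {H of CompleteNormedModule R[i] H & CompleteNormedModule_isHilbert R H}.

(* Unital C*-algebras.  The product is a field of this structure because
   Hierarchy Builder cannot join normed modules with (noncommutative) rings:
   every normed ring it knows of is a numDomainType. *)
HB.mixin Record CompleteNormedModule_isCStar (R : realType) (A : Type)
    of CompleteNormedModule R[i] A := {
  cmul : A -> A -> A;
  cone : A;
  star : A -> A;
  cmulA : forall a b c : A, cmul a (cmul b c) = cmul (cmul a b) c;
  cmul1l : forall a : A, cmul cone a = a;
  cmul1r : forall a : A, cmul a cone = a;
  cmul_linearl : forall (c : R[i]) (a b d : A),
    cmul (c *: a + b) d = c *: cmul a d + cmul b d;
  cmul_linearr : forall (c : R[i]) (a b d : A),
    cmul d (c *: a + b) = c *: cmul d a + cmul d b;
  star_semilinear : forall (c : R[i]) (a b : A),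
    star (c *: a + b) = Num.conj c *: star a + star b;
  starM : forall a b : A, star (cmul a b) = cmul (star b) (star a);
  starK : forall a : A, star (star a) = a;
  cstar_normM : forall a b : A, `|cmul a b| <= `|a| * `|b|;
  cstar_norm : forall a : A, `|cmul (star a) a| = `|a| ^+ 2
}.

#[short(type="cstarAlgType")]
HB.structure Definition CStarAlgebra (R : realType) :=
  {A of CompleteNormedModule R[i] A & CompleteNormedModule_isCStar R A}.

Section CuntzAlgebra.
Variable R : realType.

Definition cuntz_relations (n : nat) (A : cstarAlgType R) (s : 'I_n -> A) :=
  (forall i j, cmul (star (s i)) (s j) = if i == j then cone else 0) /\
  \sum_(i < n) cmul (s i) (star (s i)) = cone.

Definition cstar_subalgebra (A : cstarAlgType R) (B : set A) :=
  [/\ B cone,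
      forall (c : R[i]) a b, B a -> B b -> B (c *: a + b),
      forall a b, B a -> B b -> B (cmul a b),
      forall a, B a -> B (star a)
    & closed B].

Definition star_hom (A B : cstarAlgType R) (phi : {linear A -> B}) :=
  [/\ phi cone = cone,
      forall a b, phi (cmul a b) = cmul (phi a) (phi b)
    & forall a, phi (star a) = star (phi a)].

(* A is O_n: it is generated by s as a C*-algebra, and it is universal among
   the unital C*-algebras with a family that satisfies the relations. *)
Definition is_cuntz_algebra (n : nat) (A : cstarAlgType R) (s : 'I_n -> A) :=
  [/\ cuntz_relations s,
      smallest (@cstar_subalgebra A) (range s) = setT
    & forall (B : cstarAlgType R) (t : 'I_n -> B), cuntz_relations t ->
        exists phi : {linear A -> B},
          star_hom phi /\ forall i, phi (s i) = t i].

End CuntzAlgebra.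

(* Unital *-homomorphisms from A to the bounded operators on H; the last field
   says that pi (a^* ) is the adjoint of pi a. *)
Record representation (R : realType) (A : cstarAlgType R) (H : hilbertType R) :=
  Representation {
    rep_op :> A -> {linear H -> H};
    rep_bounded : forall a, continuous (rep_op a);
    rep_semilinear : forall (c : R[i]) a b x,
      rep_op (c *: a + b) x = c *: rep_op a x + rep_op b x;
    rep1 : forall x, rep_op cone x = x;
    repM : forall a b x, rep_op (cmul a b) x = rep_op a (rep_op b x);
    rep_star : forall a x y,
      hdot (rep_op a x) y = hdot x (rep_op (star a) y)
  }.

Section HilbertSubspaces.
Variables (R : realType) (H : hilbertType R).

Definition is_subspace (M : set H) :=
  M 0 /\ forall (c : R[i]) x y, M x -> M y -> M (c *: x + y).

Definition orthocompl (M : set H) : set H :=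
  [set x | forall y, M y -> hdot x y = 0].

Definition closed_span (X : set H) : set H :=
  smallest [set M | is_subspace M /\ closed M] X.

Definition reducing (A : cstarAlgType R) (pi : representation A H)
    (M : set H) :=
  forall a, pi a @` M `<=` M /\ pi a @` orthocompl M `<=` orthocompl M.

Definition irreducible_rep (A : cstarAlgType R) (pi : representation A H) :=
  forall M : set H, is_subspace M -> closed M -> reducing pi M ->
    M = [set 0] \/ M = setT.

(* A finite-dimensional subspace K of H, given as a vector space together with
   its inclusion map, so that B(K) is 'End(K) and the subspaces of K are the
   elements of {vspace K}.  As a subset of H, it is range (incl K). *)
Record findim_subspace := FindimSubspace {
  fds_vect :> vectType R[i];
  incl : {linear fds_vect -> H};
  incl_inj : injective incl
}.

End HilbertSubspaces.

Section OperatorsOnK.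
Variables (R : realType) (H : hilbertType R) (K : findim_subspace H).

Definition kdot (u v : K) : R[i] := hdot (incl K u) (incl K v).

(* The orthogonal projection of H onto K, with values in K. *)
Definition orthproj (x : H) : K :=
  xget 0 [set u : K | forall v : K, hdot (x - incl K u) (incl K v) = 0].

Definition compression (T : H -> H) : 'End(K) :=
  linfun (fun v : K => orthproj (T (incl K v))).

Definition adj (f : 'End(K)) : 'End(K) :=
  xget 0 [set g : 'End(K) | forall u v, kdot (f u) v = kdot u (g v)].

Definition op_le (f g : 'End(K)) :=
  adj (g - f) = g - f /\ forall v, 0 <= kdot ((g - f) v) v.

Definition is_proj (p : 'End(K)) := (p \o p)%VF = p /\ adj p = p.

Definition cp_map (m : nat) (A : 'I_m -> 'End(K)) (X : 'End(K)) : 'End(K) :=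
  \sum_(i < m) (A i \o X \o adj (A i))%VF.

(* The minimal projections p satisfying p <= Phi p. *)
Definition min_proj (Phi : 'End(K) -> 'End(K)) (p : 'End(K)) :=
  [/\ is_proj p, p <> 0, op_le p (Phi p)
    & forall q, is_proj q -> q <> 0 -> op_le q p -> op_le q (Phi q) -> q = p].

Definition adj_invariant (m : nat) (A : 'I_m -> 'End(K)) (M : {vspace K}) :=
  forall i, (adj (A i) @: M <= M)%VS.

Definition min_invariant (m : nat) (A : 'I_m -> 'End(K)) (M : {vspace K}) :=
  [/\ adj_invariant A M, M <> 0%VS
    & forall N : {vspace K},
        adj_invariant A N -> N <> 0%VS -> (N <= M)%VS -> N = M].

Definition orth_subspaces (M N : {vspace K}) :=
  forall u v, u \in M -> v \in N -> kdot u v = 0.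

Definition orth_projs (p q : 'End(K)) := (p \o q)%VF = 0.

End OperatorsOnK.

(* F is maximal, for inclusion, among the families of pairwise orth elements
   satisfying P. *)
Definition max_orth_family (T : Type) (P : T -> Prop) (orth : T -> T -> Prop)
    (F : set T) :=
  let orth_family (G : set T) :=
    (forall x, G x -> P x) /\
    (forall x y, G x -> G y -> x <> y -> orth x y) in
  orth_family F /\ forall G, orth_family G -> F `<=` G -> G = F.

(* Main.v *)
(* For p a projection and q = 1 - p, unitality of Phi turns p <= Phi p into
   Phi q <= q, which says that q A_i^* p = 0 for all i; hence p <= Phi p exactly
   when the range of p is A_i^*-invariant, and (a) follows by sending p to its
   range.

   For (b), the point is that a nonzero subspace M of H which is invariant under
   the S_i^*, has an orthogonal projection and lies in the closed span of the
   S_w K (w a word) meets K. If M and K meet trivially, finite dimension gives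
   C with |u| <= C |u - x| for u in K and x in M. Since
   |z|^2 = sum_i |S_i^* z|^2, this bound propagates to all sums of the S_w u_w,
   and density then forces M = 0.
   A reducing subspace M and its orthogonal complement therefore contain two
   distinct minimal invariant subspaces of K, unless one of them is 0.
   Conversely let N and N' be minimal invariant. The closed span of the S_w N
   reduces pi, so it is H when pi is irreducible; applied to N in place of K and
   to N' in place of M, the same fact makes N and N' meet, so N = N'.
   That a subspace reducing the S_i reduces all of O_n uses that pi is
   continuous; this is derived from the existence of square roots of 1 - h for
   |h| < 1. *)
From HB Require Import structures.
Require Import Defs.
From mathcomp Require Import ring lra.

Set Implicit Arguments.
Unset Strict Implicit.
Unset Printing Implicit Defensive.

Import Order.TTheory GRing.Theory Num.Theory.
Import numFieldNormedType.Exports.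

Local Open Scope classical_set_scope.
Local Open Scope ring_scope.
Local Open Scope complex_scope.

(** * Normed modules over the complex numbers *)

Lemma ge0_Re (R : realType) (c : R[i]) : 0 <= c -> c = (complex.Re c)%:C.
Proof. by move=> c0; apply: esym; apply: RRe_real; apply: ger0_real. Qed.

Lemma gt0_Re (R : realType) (c : R[i]) : 0 < c -> 0 < complex.Re c.
Proof. by move=> c0; rewrite -ltcR -ge0_Re// ltW. Qed.

Section RealNorm.
Variables (R : realType) (V : normedModType R[i]).
Implicit Types (x y z : V).

(** The norm takes its values in [R[i]]; its real part lies in the ordered field [R], where infima,
    limits and [lra] are available. *)
Definition nrm x : R := complex.Re `|x|.

Lemma nrmE x : `|x| = (nrm x)%:C.
Proof. exact: ge0_Re. Qed.

Lemma nrm_ge0 x : 0 <= nrm x.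
Proof. by rewrite -ler0c -nrmE. Qed.

Lemma nrmD x y : nrm (x + y) <= nrm x + nrm y.
Proof. by rewrite -lecR rmorphD /= -!nrmE ler_normD. Qed.

Lemma nrmN x : nrm (- x) = nrm x.
Proof. by rewrite /nrm normrN. Qed.

Lemma nrm_distC x y : nrm (x - y) = nrm (y - x).
Proof. by rewrite -nrmN opprB. Qed.

Lemma nrm_distD z x y : nrm (x - y) <= nrm (x - z) + nrm (z - y).
Proof. by rewrite (le_trans _ (nrmD _ _))// addrA subrK. Qed.

Lemma nrm_eq0 x : (nrm x == 0) = (x == 0).
Proof. by rewrite -(inj_eq (@complexI R)) -nrmE normr_eq0. Qed.

Lemma nrm0 : nrm (0 : V) = 0.
Proof. by apply/eqP; rewrite nrm_eq0. Qed.

Lemma nrmZ (c : R[i]) x : nrm (c *: x) = complex.Re `|c| * nrm x.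
Proof.
apply: (@complexI R).
by rewrite -nrmE normrZ rmorphM /= -nrmE; congr (_ * _); exact: ge0_Re.
Qed.

Lemma nrmZr (c : R) x : nrm (c%:C *: x) = `|c| * nrm x.
Proof. by rewrite nrmZ normc_def /= expr0n addr0 sqrtr_sqr. Qed.

Lemma ballP x y (e : R) : ball x e%:C y <-> nrm (x - y) < e.
Proof. by rewrite -ball_normE /ball_/= nrmE ltcR. Qed.

Lemma nbhs_nrmP x (A : set V) :
  nbhs x A <-> exists2 e : R, 0 < e & forall y, nrm (x - y) < e -> A y.
Proof.
split.
- move=> /nbhs_ballP[e /= e0 eA]; exists (complex.Re e); first exact: gt0_Re.
  by move=> y /ballP yx; apply: eA; rewrite -ge0_Re ?ltW in yx.
- move=> [e e0 eA]; apply/nbhs_ballP; exists e%:C; first by rewrite /= ltcR.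
  by move=> y /ballP; apply: eA.
Qed.

Lemma closureP (A : set V) x :
  closure A x <-> forall e : R, 0 < e -> exists2 y, A y & nrm (x - y) < e.
Proof.
split=> [clAx e e0|Ax B /nbhs_nrmP[e e0 eB]].
- have [|y [Ay By]] := clAx [set y | nrm (x - y) < e].
    by apply/nbhs_nrmP; exists e.
  by exists y.
- by have [y Ay /eB By] := Ax e e0; exists y.
Qed.

Lemma closedP (A : set V) : closed A <->
  forall x, (forall e : R, 0 < e -> exists2 y, A y & nrm (x - y) < e) -> A x.
Proof.
by split=> clA x => [/closureP|/closureP]; [exact: clA|exact: clA].
Qed.

End RealNorm.

(** By linearity a modulus of continuity at 0 serves at every point. *)
Lemma linear_continuous_nrm (R : realType) (V W : normedModType R[i])
    (f : {linear V -> W}) (e : R) : continuous f -> 0 < e ->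
  exists2 d : R, 0 < d & forall x y, nrm (x - y) < d -> nrm (f x - f y) < e.
Proof.
move=> fc e0.
have /nbhs_nrmP[d d0 dH] : nbhs (0 : V) (f @^-1` [set y | nrm (f 0 - y) < e]).
  by apply: fc; apply/nbhs_nrmP; exists e.
exists d => // x y xy; have := dH (y - x).
by rewrite /= (raddf0 f) (raddfB f) !sub0r !nrmN nrm_distC => /(_ xy); rewrite nrm_distC.
Qed.

(** * Cauchy sequences and the contraction principle *)

Section Completeness.
Variables (R : realType) (V : completeNormedModType R[i]).

Lemma nrm_complete (u : nat -> V) :
  (forall e : R, 0 < e ->
     exists N, forall n m, (N <= n)%N -> (N <= m)%N -> nrm (u n - u m) < e) ->
  exists l, forall e : R, 0 < e ->
     exists N, forall n, (N <= n)%N -> nrm (l - u n) < e.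
Proof.
move=> uC.
have : cvgn u.
  apply/cauchy_cvgP; apply/cauchy_ballP => e e0.
  have [|N NP] := uC (complex.Re e); first exact: gt0_Re.
  near_simpl.
  exists ([set n | (N <= n)%N], [set n | (N <= n)%N]); first by split; exists N.
  move=> [n m] /= [Nn Nm].
  by rewrite (ge0_Re (ltW e0)); apply/ballP; exact: NP.
move=> /cvg_ex[l ul]; exists l => e e0.
have [|N _ NP] := ul [set y | nrm (l - y) < e].
  by apply/nbhs_nrmP; exists e.
by exists N => n Nn; apply: NP.
Qed.

(** Banach's argument: the steps between iterates of [x0] decay like [r ^+ n], so the iterates are
    Cauchy. They stay in [D], and so does their limit. *)
Lemma contraction_fixpoint (D : set V) (F : V -> V) (r : R) (x0 : V) :
  0 <= r < 1 -> closed D -> D x0 -> (forall x, D x -> D (F x)) ->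
  (forall x y, D x -> D y -> nrm (F x - F y) <= r * nrm (x - y)) ->
  exists2 l, D l & F l = l.
Proof.
move=> /andP[r0 r1] cD Dx0 DF Fr; pose u n := iter n F x0.
have Du n : D (u n) by elim: n => //= n /DF.
pose d := nrm (u 1%N - u 0%N).
have d1 n : nrm (u n.+1 - u n) <= r ^+ n * d.
  elim: n => [|n IH]; first by rewrite expr0 mul1r.
  apply: le_trans (Fr (u n.+1) (u n) (Du _) (Du _)) _.
  by rewrite exprS -mulrA ler_wpM2l.
have r1' : 0 < 1 - r by rewrite subr_gt0.
(* Partial sum of the geometric series of the steps bounded in [d1]. *)
have dk n k : nrm (u (n + k)%N - u n) <= r ^+ n * d * ((1 - r ^+ k) / (1 - r)).
  elim: k => [|k IH].
    by rewrite addn0 subrr nrm0 expr0 subrr mul0r mulr0.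
  rewrite addnS (le_trans (nrm_distD (u (n + k)%N) _ _))//.
  rewrite (le_trans (lerD (d1 _) IH))// exprD.
  rewrite mulrAC -mulrDr ler_wpM2l ?mulr_ge0 ?exprn_ge0 ?nrm_ge0//.
  rewrite -[X in X + _](@mulfK _ (1 - r)) ?gt_eqF// -mulrDl.
  by rewrite ler_pM2r ?invr_gt0// exprS; lra.
have uN e : 0 < e -> exists N, forall n, (N <= n)%N -> nrm (u n - u N) < e.
  (* This [N] makes [r ^+ N * d / (1 - r)] smaller than [e]; the divisor [d + 1] stays positive when
     [d] is 0. *)
  move=> e0; have [N _ NP] : \forall n \near \oo, r ^+ n < e * (1 - r) / (d + 1).
    have : r ^+ n @[n --> \oo] --> (0 : R).
      by apply: cvg_expr; rewrite ger0_norm.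
    move=> /cvgrPdist_lt /(_ (e * (1 - r) / (d + 1))).
    have d10 : 0 < d + 1 by rewrite ltr_wpDl ?nrm_ge0.
    rewrite divr_gt0 ?mulr_gt0// => /(_ isT)[N _ NP]; exists N => // n /NP /=.
    by rewrite sub0r normrN ger0_norm// exprn_ge0.
  exists N => n Nn; rewrite -(subnKC Nn) (le_lt_trans (dk _ _))//.
  have := NP _ (leqnn N); rewrite ltr_pdivlMr ?ltr_wpDl ?nrm_ge0// => NP'.
  rewrite mulrA ltr_pdivrMr//; apply: le_lt_trans NP'.
  have rk : 0 <= r ^+ (n - N) by rewrite exprn_ge0.
  have rN : 0 <= r ^+ N by rewrite exprn_ge0.
  have d0 : 0 <= d by rewrite nrm_ge0.
  have rNd : 0 <= r ^+ N * d by rewrite mulr_ge0.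
  rewrite (@le_trans _ _ (r ^+ N * d))// ?ler_wpM2l ?lerDl//.
  by rewrite -[leRHS]mulr1 ler_wpM2l// lerBlDr lerDl.
have [|l lP] := @nrm_complete u.
  move=> e e0; have [|N NP] := uN (e / 2); first by rewrite divr_gt0.
  exists N => n m Nn Nm; rewrite (le_lt_trans (nrm_distD (u N) _ _))//.
  by rewrite [ltRHS](splitr e) ltrD// ?NP// nrm_distC NP.
have Dl : D l.
  move/closedP : cD; apply => e /lP[N NP]; exists (u N) => //; exact: NP.
exists l => //; apply/eqP; rewrite -subr_eq0 -nrm_eq0 eq_le nrm_ge0 andbT.
apply/ler_addgt0Pr => e e0; rewrite add0r.
have [|N NP] := lP (e / 2); first by rewrite divr_gt0.
rewrite (le_trans (nrm_distD (u N.+1) _ _))// [leRHS](splitr e) lerD//.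
  rewrite (le_trans (Fr _ _ Dl (Du N)))// (@le_trans _ _ (1 * nrm (l - u N)))//.
    by rewrite ler_wpM2r ?nrm_ge0// ltW.
  by rewrite mul1r ltW// NP.
by rewrite nrm_distC ltW// NP.
Qed.

End Completeness.

(** * Hilbert spaces and orthogonal projections *)

Section HilbertGeometry.
Variables (R : realType) (H : hilbertType R).
Implicit Types (x y z : H).

Lemma hdotDl x y z : hdot (x + y) z = hdot x z + hdot y z.
Proof. exact: linearDl. Qed.

Lemma hdotBl x y z : hdot (x - y) z = hdot x z - hdot y z.
Proof. exact: linearBl. Qed.

Lemma hdotZl c x z : hdot (c *: x) z = c * hdot x z.
Proof. exact: linearZl_LR. Qed.

Lemma hdot0l z : hdot 0 z = 0.
Proof. exact: linear0l. Qed.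

Lemma hdotC x y : hdot x y = Num.conj (hdot y x).
Proof. by rewrite (hermC (hdot : {dot H for Num.conj})) mul1r. Qed.

Lemma hdotDr x y z : hdot z (x + y) = hdot z x + hdot z y.
Proof. exact: linearDr. Qed.

Lemma hdotBr x y z : hdot z (x - y) = hdot z x - hdot z y.
Proof. exact: linearBr. Qed.

Lemma hdotZr c x z : hdot z (c *: x) = Num.conj c * hdot z x.
Proof. exact: linearZr_LR. Qed.

Lemma hdot0r z : hdot z 0 = 0.
Proof. exact: linear0r. Qed.

Lemma hdot_suml I (r : seq I) (F : I -> H) z :
  hdot (\sum_(i <- r) F i) z = \sum_(i <- r) hdot (F i) z.
Proof.
elim/big_rec2: _ => [|i a b _ <-]; [exact: hdot0l | exact: hdotDl].
Qed.

Lemma hdot_sumr I (r : seq I) (F : I -> H) z :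
  hdot z (\sum_(i <- r) F i) = \sum_(i <- r) hdot z (F i).
Proof.
elim/big_rec2: _ => [|i a b _ <-]; [exact: hdot0r | exact: hdotDr].
Qed.

Lemma hdot_eq0C x y : hdot x y = 0 -> hdot y x = 0.
Proof. by move=> xy; rewrite hdotC xy conjC0. Qed.

Lemma hdot_nrm x : hdot x x = (nrm x ^+ 2)%:C.
Proof. by rewrite hdot_norm nrmE rmorphXn. Qed.

Lemma hdot_ge0 x : 0 <= hdot x x.
Proof. by rewrite hdot_nrm ler0c exprn_ge0// nrm_ge0. Qed.

Lemma hdot_eq0 x : (hdot x x == 0) = (x == 0).
Proof. by rewrite hdot_norm sqrf_eq0 normr_eq0. Qed.

Lemma pythagoras x y : hdot x y = 0 ->
  nrm (x + y) ^+ 2 = nrm x ^+ 2 + nrm y ^+ 2.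
Proof.
move=> xy; apply: (@complexI R); rewrite rmorphD /= -!hdot_nrm.
by rewrite hdotDl !hdotDr xy (hdot_eq0C xy) addr0 add0r.
Qed.

Lemma parallelogram x y :
  nrm (x + y) ^+ 2 + nrm (x - y) ^+ 2 = 2 * (nrm x ^+ 2 + nrm y ^+ 2).
Proof.
have : hdot (x + y) (x + y) + hdot (x - y) (x - y) =
    hdot x x + hdot y y + (hdot x x + hdot y y).
  by rewrite hdotBl !hdotBr hdotDl !hdotDr; ring.
rewrite !hdot_nrm -!(rmorphD (real_complex R)) => /complexI ->; lra.
Qed.

(** One Gram-Schmidt step. For [y = 0] the quotient used as coefficient is 0 by convention, and
    orthogonality is trivial. *)
Lemma hdot_decomp x y : exists2 c, x = c *: y + (x - c *: y) &
  hdot (x - c *: y) y = 0.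
Proof.
exists (hdot x y / hdot y y); first by rewrite addrC subrK.
have [->|y0] := eqVneq y 0; first by rewrite hdot0r.
by rewrite hdotBl hdotZl divfK ?subrr// hdot_eq0.
Qed.

(** By Pythagoras the component [c *: y] of [x] along [y] is no longer than [x], and it alone
    contributes to the inner product. *)
Lemma cauchy_schwarz x y : complex.Re `|hdot x y| <= nrm x * nrm y.
Proof.
have [c xE /[dup] ort /hdot_eq0C ort'] := hdot_decomp x y.
have -> : hdot x y = c * hdot y y by rewrite {1}xE hdotDl ort addr0 hdotZl.
have : nrm (c *: y) <= nrm x.
  rewrite -ler_sqr ?nnegrE ?nrm_ge0// xE pythagoras.
    by rewrite lerDl exprn_ge0// nrm_ge0.
  by rewrite hdotZl ort' mulr0.
have -> : `|c * hdot y y| = `|c *: y| * `|y|.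
  by rewrite normrM hdot_norm normrX normr_id normrZ expr2 mulrA.
rewrite !nrmE -(rmorphM (real_complex R)) /= => le.
by rewrite ler_wpM2r// nrm_ge0.
Qed.

(** Adding to [m] the component of [x - m] along [y] stays in [M] and would reduce the squared
    distance to [x] by the squared norm of that component, which is therefore 0. *)
Lemma closest_orthogonal (M : set H) x m : is_subspace M -> M m ->
  (forall y, M y -> nrm (x - m) <= nrm (x - y)) ->
  forall y, M y -> hdot (x - m) y = 0.
Proof.
move=> [M0 ML] Mm min y My.
have [c zE ort] := hdot_decomp (x - m) y.
have : nrm (c *: y) ^+ 2 <= 0.
  have := min (c *: y + m) (ML _ _ _ My Mm).
  rewrite opprD addrCA addrC -ler_sqr ?nnegrE ?nrm_ge0// => le.
  rewrite -(lerD2r (nrm (x - m - c *: y) ^+ 2)) -pythagoras.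
    by rewrite -zE add0r.
  by rewrite hdotZl (hdot_eq0C ort) mulr0.
rewrite exprn_even_le0//= nrm_eq0 => /eqP cy.
by rewrite -ort cy subr0.
Qed.

Theorem orthogonal_projection (M : set H) x : is_subspace M -> closed M ->
  exists2 m, M m & forall y, M y -> hdot (x - m) y = 0.
Proof.
move=> Msub cM; have [M0 ML] := Msub.
pose D := [set nrm (x - m) | m in M]; pose d := inf D.
have D0 : D !=set0 by exists (nrm (x - 0)); exists 0.
have Dinf : has_inf D.
  by split=> //; exists 0 => _ [m _ <-]; exact: nrm_ge0.
have d_le m : M m -> d <= nrm (x - m).
  by move=> Mm; apply: ge_inf; [case: Dinf | exists m].
have d0 : 0 <= d by apply: lb_le_inf => // _ [m _ <-]; exact: nrm_ge0.
have near n : exists m, M m /\ nrm (x - m) < d + n.+1%:R^-1.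
  have [|_ [m Mm <-] lt] := @inf_adherent _ D n.+1%:R^-1 _ Dinf.
    by rewrite invr_gt0 ltr0n.
  by exists m.
have [u uP] := choice near.
(* In the parallelogram law for [x - u n] and [x - u k], the midpoint of [u n] and [u k] lies in
   [M], hence at distance at least [d] from [x]. What remains is at most [4 (d + e)^2 - 4 d^2],
   which is at most [e (8 d + 4)] because [e <= 1]. *)
have dist n k (e : R) : n.+1%:R^-1 <= e -> k.+1%:R^-1 <= e -> e <= 1 ->
    nrm (u n - u k) ^+ 2 <= e * (8 * d + 4).
  move=> ne ke e1; have [[Mn dn] [Mk dk]] := (uP n, uP k).
  have e0 : 0 <= e by apply: le_trans ne; rewrite invr_ge0.
  have := parallelogram (x - u n) (x - u k).
  have -> : x - u n - (x - u k) = u k - u n.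
    by rewrite opprB addrC addrA subrK.
  have -> : x - u n + (x - u k) = (2%:R : R)%:C *: (x - (2^-1 : R)%:C *: (u n + u k)).
    rewrite scalerBr scalerA -rmorphM /= divff ?scale1r// rmorph_nat.
    by rewrite scaler_nat mulr2n addrACA opprD.
  rewrite nrmZr ger0_norm// exprMn (nrm_distC (u n)).
  have dm : d <= nrm (x - (2^-1 : R)%:C *: (u n + u k)).
    apply: d_le; rewrite -[_ *: _]addr0; apply: (ML) => //.
    by rewrite -[u n]scale1r; apply: ML.
  have := nrm_ge0 (x - u n); have := nrm_ge0 (x - u k).
  have {}dn : nrm (x - u n) <= d + e by rewrite (le_trans (ltW dn))// lerD2l.
  have {}dk : nrm (x - u k) <= d + e by rewrite (le_trans (ltW dk))// lerD2l.
  move: (nrm (x - u n)) (nrm (x - u k)) dn dk => a b dn dk.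
  move: (nrm (x - (2^-1 : R)%:C *: (u n + u k))) dm => c dm b0 a0.
  move: (nrm (u k - u n)) => f E.
  have ha : a ^+ 2 <= (d + e) ^+ 2.
    by rewrite ler_sqr ?nnegrE//; lra.
  have hb : b ^+ 2 <= (d + e) ^+ 2.
    by rewrite ler_sqr ?nnegrE//; lra.
  have hc : d ^+ 2 <= c ^+ 2.
    by rewrite ler_sqr ?nnegrE//; lra.
  have : e ^+ 2 <= e by rewrite expr2 ler_piMr.
  have : (d + e) ^+ 2 = d ^+ 2 + 2 * (e * d) + e ^+ 2 by rewrite sqrrD; lra.
  have : e * (8 * d + 4) = 8 * (e * d) + 4 * e by lra.
  have : 0 <= e * d by rewrite mulr_ge0.
  lra.
have invN (e : R) : 0 < e ->
    exists N, forall n, (N <= n)%N -> n.+1%:R^-1 <= e.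
  move=> e0; have [N _ NP] := near_infty_natSinv_lt (PosNum e0).
  by exists N => n Nn; apply/ltW/NP.
have [e e0|l lP] := @nrm_complete R H u.
  (* The minimum with 1 meets the condition [e <= 1] of [dist]; 5 in place of 4 makes the final
     inequality strict. *)
  pose e' := Order.min 1 (e ^+ 2 / (8 * d + 5)).
  have d5 : 0 < 8 * d + 5 by lra.
  have e'0 : 0 < e' by rewrite lt_min ltr01 divr_gt0// exprn_gt0.
  have [N NP] := invN _ e'0.
  exists N => n k Nn Nk; rewrite -ltr_sqr ?nnegrE ?nrm_ge0 ?ltW//.
  rewrite (le_lt_trans (dist _ _ _ (NP _ Nn) (NP _ Nk) _)) ?ge_min ?lexx//.
  rewrite (@lt_le_trans _ _ (e' * (8 * d + 5)))//; first by rewrite ltr_pM2l//; lra.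
  by rewrite -ler_pdivlMr// ge_min lexx orbT.
have Ml : M l.
  move/closedP : cM; apply => e /lP[N NP].
  by exists (u N); [case: (uP N) | exact: NP].
exists l => //; apply: closest_orthogonal => // y My.
apply: le_trans (d_le _ My); apply/ler_addgt0Pr => e e0.
have e20 : 0 < e / 2 by rewrite divr_gt0.
have [[N NP] [N' NP']] := (lP _ e20, invN _ e20).
pose n := maxn N N'; have [Mn dn] := uP n.
rewrite (le_trans (nrm_distD (u n) _ _))//.
have := NP' n (leq_maxr _ _); have := NP n (leq_maxl _ _).
rewrite (nrm_distC l); move=> lt_e le_e.
have add a b i d' e' : a < d' + i -> i <= e' / 2 -> b < e' / 2 -> a + b <= d' + e' :> R.
  lra.
exact: add dn le_e lt_e.
Qed.

End HilbertGeometry.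

(** * Finite-dimensional subspaces, adjoints and projections *)

Section FiniteDimensional.
Variables (R : realType) (H : hilbertType R).

Section Kdot.
Variable K : findim_subspace H.
Implicit Types (u v w : K).

Lemma kdotC u v : kdot u v = Num.conj (kdot v u).
Proof. exact: hdotC. Qed.

Lemma kdotBl u v w : kdot (u - v) w = kdot u w - kdot v w.
Proof. by rewrite /kdot linearB hdotBl. Qed.

Lemma kdotBr u v w : kdot w (u - v) = kdot w u - kdot w v.
Proof. by rewrite /kdot linearB hdotBr. Qed.

Lemma kdot0l u : kdot 0 u = 0.
Proof. by rewrite /kdot linear0 hdot0l. Qed.

Lemma kdot0r u : kdot u 0 = 0.
Proof. by rewrite /kdot linear0 hdot0r. Qed.

Lemma kdot_suml I (r : seq I) (F : I -> K) v :
  kdot (\sum_(i <- r) F i) v = \sum_(i <- r) kdot (F i) v.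
Proof. by rewrite /kdot linear_sum hdot_suml. Qed.

Lemma kdot_sumr I (r : seq I) (F : I -> K) v :
  kdot v (\sum_(i <- r) F i) = \sum_(i <- r) kdot v (F i).
Proof. by rewrite /kdot linear_sum hdot_sumr. Qed.

Lemma kdotZr c u v : kdot u (c *: v) = Num.conj c * kdot u v.
Proof. by rewrite /kdot linearZ hdotZr. Qed.

Lemma kdot_ge0 u : 0 <= kdot u u.
Proof. exact: hdot_ge0. Qed.

Lemma incl_eq0 u : (incl K u == 0) = (u == 0).
Proof. by rewrite -(inj_eq (@incl_inj _ _ K)) linear0. Qed.

Lemma kdot_eq0 u : (kdot u u == 0) = (u == 0).
Proof. by rewrite /kdot hdot_eq0 incl_eq0. Qed.

Lemma kdot_eq0C u v : kdot u v = 0 -> kdot v u = 0.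
Proof. exact: hdot_eq0C. Qed.

Lemma kdot_ext u v : (forall w, kdot u w = kdot v w) -> u = v.
Proof.
by move=> uv; apply/eqP; rewrite -subr_eq0 -kdot_eq0 kdotBl uv subrr.
Qed.

End Kdot.

(** * Inner products against a finite family *)

Section GramMap.
Variables (K : findim_subspace H) (m : nat).
Implicit Type g : 'I_m -> H.

Definition gram_fun g (u : K) : 'rV[R[i]]_m := \row_i hdot (incl K u) (g i).

Lemma gram_fun_linear g : linear (gram_fun g).
Proof.
by move=> c u v; apply/rowP => i; rewrite !mxE linearP hdotDl hdotZl.
Qed.

HB.instance Definition _ g :=
  GRing.isLinear.Build _ _ _ _ (gram_fun g) (gram_fun_linear g).

Definition gram g : 'Hom(K, 'rV[R[i]]_m) := linfun (gram_fun g).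

Lemma gramE g u i : gram g u 0 i = hdot (incl K u) (g i).
Proof. by rewrite lfunE /= mxE. Qed.

Lemma gram_lker0 g :
  (forall u : K, (forall i, hdot (incl K u) (g i) = 0) -> u = 0) ->
  lker (gram g) == 0%VS.
Proof.
move=> g0; rewrite -subv0; apply/subvP => u; rewrite memv_ker memv0 => /eqP gu.
by apply/eqP/g0 => i; rewrite -gramE gu mxE.
Qed.

(** The inverse images of the unit vectors form a dual family: a left inverse of the injective Gram
    map recovers [u] from its inner products. *)
Lemma gram_reconstruction g : lker (gram g) == 0%VS ->
  exists w : 'I_m -> K, forall u, u = \sum_i hdot (incl K u) (g i) *: w i.
Proof.
move=> g0; exists (fun i => (gram g)^-1%VF (delta_mx 0 i)) => u.
rewrite -{1}(lker0_lfunK g0 u) (row_sum_delta (gram g u)) linear_sum.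
by apply: eq_bigr => i _; rewrite linearZ gramE.
Qed.

End GramMap.

Section Adjoint.
Variable K : findim_subspace H.
Implicit Types (u v : K) (f g p q : 'End(K)).

Local Notation n := (\dim {: K}).
Let e (i : 'I_n) : K := (vbasis fullv)`_i.

Let basis_sum u : u = \sum_i coord (vbasis fullv) i u *: e i.
Proof. exact: coord_vbasis (memvf _). Qed.

Let gram_e := gram K (fun i => incl K (e i)).

Let gram_e_ker : lker gram_e == 0%VS.
Proof.
apply: gram_lker0 => u ue; apply/eqP; rewrite -kdot_eq0 {2}(basis_sum u).
by rewrite kdot_sumr big1// => i _; rewrite kdotZr [kdot _ _]ue mulr0.
Qed.

(** An injective map between spaces of equal dimension is onto. *)
Let gram_eK : cancel gram_e^-1%VF gram_e.
Proof.
move=> r; suff /limg_lfunVK : r \in limg gram_e by [].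
suff -> : limg gram_e = fullv by exact: memvf.
apply/eqP; rewrite eqEdim subvf limg_dim_eq; last first.
  by rewrite (eqP gram_e_ker) capv0.
by rewrite dimvf /dim /= mul1n.
Qed.

(** Riesz representation: [gram_e^-1 r] is the vector whose inner product with [e i] is [r 0 i].
    Conjugates appear since [kdot] is conjugate-linear in its second argument. *)
Let gram_e_inv r u :
  kdot (gram_e^-1%VF r) u = \sum_i Num.conj (coord (vbasis fullv) i u) * r 0 i.
Proof.
rewrite {1}(basis_sum u) kdot_sumr; apply: eq_bigr => i _.
by rewrite kdotZr -[in RHS](gram_eK r) gramE.
Qed.

Lemma orthproj_orth (x : H) v : hdot (x - incl K (orthproj K x)) (incl K v) = 0.
Proof.
rewrite /orthproj; case: xgetP => [u _|none]; first exact.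
(* The set from which [xget] chooses is inhabited: take the vector of [K] having the same inner
   products as [x] with the basis. *)
exfalso; apply: (none (gram_e^-1%VF (\row_i hdot x (incl K (e i))))) => w.
rewrite hdotBl [X in _ - X]gram_e_inv {1}(basis_sum w) linear_sum hdot_sumr.
apply/eqP; rewrite subr_eq0; apply/eqP; apply: eq_bigr => i _.
by rewrite linearZ hdotZr mxE.
Qed.

Lemma orthproj_unique (x : H) u :
  (forall v, hdot (x - incl K u) (incl K v) = 0) -> orthproj K x = u.
Proof.
move=> xu; apply: kdot_ext => v; apply/eqP; rewrite -subr_eq0 -kdotBl /kdot.
have := xu v; rewrite -[RHS](orthproj_orth x v) !hdotBl linearB hdotBl.
by move=> /eqP; rewrite (inj_eq (addrI _)) (inj_eq oppr_inj) subr_eq0 eq_sym.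
Qed.

Lemma orthproj_linear : linear (orthproj K).
Proof.
move=> c x y; apply: orthproj_unique => v.
rewrite linearP opprD addrACA -scalerBr hdotDl hdotZl.
by rewrite !orthproj_orth mulr0 addr0.
Qed.

(** [linfun] is known to agree with its argument only when that argument carries a linear structure,
    so one is packed here. *)
Lemma compressionE (T : {linear H -> H}) u :
  compression K T u = orthproj K (T (incl K u)).
Proof.
have Llin : linear (fun v : K => orthproj K (T (incl K v))).
  by move=> c v w; rewrite !linearP orthproj_linear.
pose L : {linear K -> K} := HB.pack (fun v : K => orthproj K (T (incl K v)))
  (GRing.isLinear.Build _ _ _ _ _ Llin).
exact: (lfunE L u).
Qed.

Lemma adjP f u v : kdot (f u) v = kdot u (adj f v).
Proof.
rewrite /adj; case: xgetP => [g _|none]; first exact.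
exfalso; pose fe i := incl K (f (e i)).
(* This map sends [v] to the vector whose inner product with each [e i] is that of [v] with
   [f (e i)]. *)
apply: (none (gram_e^-1 \o gram K fe)%VF) => {}u {}v.
rewrite [RHS]kdotC lfunE /= gram_e_inv rmorph_sum /= {1}(basis_sum u).
rewrite linear_sum kdot_suml; apply: eq_bigr => i _.
rewrite linearZ /= gramE rmorphM /= conjCK.
by rewrite /kdot linearZ hdotZl [hdot (incl K v) _]hdotC conjCK.
Qed.

Lemma adj_unique f g : (forall u v, kdot (f u) v = kdot u (g v)) -> adj f = g.
Proof.
move=> fg; apply/lfunP => v; apply: kdot_ext => u.
by rewrite kdotC -adjP fg -kdotC.
Qed.

Lemma adj_adjP f u v : kdot (adj f u) v = kdot u (f v).
Proof. by rewrite kdotC -adjP -kdotC. Qed.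

Lemma adjB f g : adj (f - g) = adj f - adj g.
Proof.
apply: adj_unique => u v.
by rewrite !lfun_simp kdotBl kdotBr !adjP.
Qed.

Lemma proj_kdot p u v : is_proj p -> kdot (p u) v = kdot u (p v).
Proof. by move=> [_ pa]; rewrite adjP pa. Qed.

Lemma proj_idem p u : is_proj p -> p (p u) = p u.
Proof. by move=> [pp _]; rewrite -{3}pp comp_lfunE. Qed.

Lemma mem_limg_proj p u : is_proj p -> (u \in limg p) = (p u == u).
Proof.
move=> pp; apply/idP/eqP => [/memv_imgP[w _ ->]|<-]; first exact: proj_idem.
exact: memv_img (memvf _).
Qed.

Lemma proj_pythagoras p u : is_proj p ->
  kdot u u = kdot (p u) (p u) + kdot (u - p u) (u - p u).
Proof.
move=> pp; rewrite kdotBl !kdotBr -!(proj_kdot _ _ pp) (proj_idem _ pp).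
by rewrite (proj_kdot u) //; ring.
Qed.

(** Each projection fixes the range of the other, so [q p = p] and [p q = q]; taking adjoints in the
    first gives [p = p q = q]. *)
Lemma proj_unique p q : is_proj p -> is_proj q -> limg p = limg q -> p = q.
Proof.
move=> pp pq pqE; apply/lfunP => u; apply: kdot_ext => v.
have qp w : q (p w) = p w.
  by apply/eqP; rewrite -mem_limg_proj// -pqE mem_limg_proj// proj_idem.
have pq' w : p (q w) = q w.
  by apply/eqP; rewrite -mem_limg_proj// pqE mem_limg_proj// proj_idem.
by rewrite -qp (proj_kdot (p u))// proj_kdot// pq' -proj_kdot.
Qed.

(** If [q v = v], the inequality at [v] reads [0 <= - |v - p v|^2], so [p v = v]. Conversely,
    inclusion of ranges gives [p q = q p = q], and the quadratic form of [p - q] is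
    [|p v - q v|^2]. *)
Lemma op_le_proj p q : is_proj p -> is_proj q ->
  op_le q p <-> (limg q <= limg p)%VS.
Proof.
move=> pp pq; split=> [[_ qp]|/subvP qp].
  apply/subvP => v; rewrite !mem_limg_proj// => /eqP qv.
  have E : kdot (p v) v = kdot (p v) (p v).
    by rewrite -(proj_kdot (p v))// proj_idem.
  have := qp v; rewrite !lfun_simp kdotBl qv subr_ge0 E (proj_pythagoras v pp).
  rewrite gerDl => le0.
  have : kdot (v - p v) (v - p v) == 0 by rewrite eq_le le0 kdot_ge0.
  by rewrite kdot_eq0 subr_eq0 eq_sym.
have pq' w : p (q w) = q w.
  by apply/eqP; rewrite -mem_limg_proj// qp// mem_limg_proj// proj_idem.
have qp' w : q (p w) = q w.
  by apply: kdot_ext => v; rewrite !(proj_kdot _ _ pp, proj_kdot _ _ pq) pq'.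
split=> [|v]; first by rewrite adjB; case: pp => _ ->; case: pq => _ ->.
rewrite !lfun_simp.
have -> : kdot (p v - q v) v = kdot (p v - q v) (p v - q v).
  rewrite kdotBr -!(proj_kdot _ _ pp, proj_kdot _ _ pq).
  by rewrite !linearB /= pq' qp' !proj_idem// subrr kdot0l subr0.
exact: kdot_ge0.
Qed.

Lemma orth_projsP p q : is_proj p -> is_proj q ->
  orth_projs p q <-> orth_subspaces (limg p) (limg q).
Proof.
move=> pp pq; split=> [opq u v|opq].
  rewrite !mem_limg_proj// => /eqP <- /eqP <-.
  by rewrite proj_kdot// -comp_lfunE opq lfunE /= kdot0r.
apply/lfunP => u; rewrite comp_lfunE lfunE /=; apply: kdot_ext => v.
rewrite kdot0l proj_kdot//; apply/kdot_eq0C/opq; exact: memv_img (memvf _).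
Qed.

End Adjoint.

Section SubspaceProjection.
Variable K : findim_subspace H.

Lemma sub_incl_inj (M : {vspace K}) :
  injective (incl K \o (vsval : {linear subvs_of M -> K})).
Proof. by move=> u v /= /incl_inj/val_inj. Qed.

(** Viewing a subspace of [K] as a finite-dimensional subspace of [H] makes results about a general
    [K] applicable to it. *)
Definition sub_findim (M : {vspace K}) : findim_subspace H :=
  @FindimSubspace _ _ (subvs_of M) _ (@sub_incl_inj M).

Lemma exists_proj (M : {vspace K}) : exists2 p : 'End(K), is_proj p & limg p = M.
Proof.
(* The orthogonal projection of [H] onto [M], restricted to [K]. *)
pose P u : K := vsval (orthproj (sub_findim M) (incl K u)).
have Plin : linear P by move=> c u v; rewrite /P linearP orthproj_linear linearP.
pose L : {linear K -> K} := HB.pack P (GRing.isLinear.Build _ _ _ _ _ Plin).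
pose p : 'End(K) := linfun L.
have pE u : p u = P u by exact: lfunE.
have PM u : p u \in M by rewrite pE; exact: subvsP.
have orth u v : v \in M -> kdot (u - p u) v = 0.
  move=> vM; have := @orthproj_orth (sub_findim M) (incl K u) (vsproj M v).
  by rewrite /= vsprojK// pE /kdot linearB.
have pid v : v \in M -> p v = v.
  move=> vM; apply/eqP; rewrite eq_sym -subr_eq0 -kdot_eq0; apply/eqP.
  by apply: orth; rewrite rpredB.
exists p; last first.
  apply/eqP; rewrite eqEsubv; apply/andP; split; apply/subvP => v.
    by move=> /memv_imgP[w _ ->].
  by move=> vM; rewrite -(pid _ vM); exact: memv_img (memvf _).
split; first by apply/lfunP => u; rewrite comp_lfunE pid.
apply: adj_unique => u v; apply/eqP; rewrite -subr_eq0.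
have -> : kdot u (p v) = kdot (p u) (p v).
  by apply/eqP; rewrite -subr_eq0 -kdotBl orth.
by rewrite -kdotBr; apply/eqP/kdot_eq0C/orth.
Qed.

End SubspaceProjection.
End FiniteDimensional.

(** * The inequality p <= Phi p and invariant subspaces *)

(** Maximality transfers along a bijection that matches the two orthogonality relations. As [f] is
    injective only on [prT], preimages of families are cut down to [prT]. *)
Lemma max_orth_family_image (S T : Type) (f : T -> S)
    (prT : T -> Prop) (prS : S -> Prop)
    (orthT : T -> T -> Prop) (orthS : S -> S -> Prop) :
  (forall p, prT p -> prS (f p)) ->
  (forall M, prS M -> exists2 p, prT p & f p = M) ->
  (forall p q, prT p -> prT q -> f p = f q -> p = q) ->
  (forall p q, prT p -> prT q -> orthT p q <-> orthS (f p) (f q)) ->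
  forall F : set S, max_orth_family prS orthS F <->
    exists2 P : set T, max_orth_family prT orthT P & F = f @` P.
Proof.
move=> fpr fsurj finj forth F; split.
- move=> [[Fpr Forth] Fmax]; exists [set p | prT p /\ F (f p)].
    split=> [|G [Gpr Gorth] FG].
      split=> [p []//|p q [pp Fp] [pq Fq] neq].
      by apply/forth => //; apply: Forth => // /finj => /(_ pp pq).
    apply/seteqP; split=> [p Gp|]; last exact: FG.
    split; first exact: Gpr.
    rewrite -(Fmax (f @` G)); first by exists p.
      split=> [_ [q Gq <-]|_ _ [q Gq <-] [r Gr <-] neq]; first exact/fpr/Gpr.
      apply/forth; try exact: Gpr.
      by apply: Gorth => // qr; apply: neq; rewrite qr.
    move=> M FM; have [q pq qM] := fsurj M (Fpr _ FM).
    by exists q => //; apply: FG; split=> //; rewrite qM.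
  apply/seteqP; split=> [M FM|_ [p [_ Fp] <-]//].
  by have [p pp pM] := fsurj M (Fpr _ FM); exists p => //; split=> //; rewrite pM.
- move=> [P [[Ppr Porth] Pmax] ->]; split=> [|G [Gpr Gorth] PG].
    split=> [_ [p Pp <-]|_ _ [p Pp <-] [q Pq <-] neq]; first exact/fpr/Ppr.
    apply/forth; try exact: Ppr.
    by apply: Porth => // pq; apply: neq; rewrite pq.
  apply/seteqP; split=> // M GM; have [p pp pM] := fsurj M (Gpr _ GM).
  exists p => //; rewrite -(Pmax [set p | prT p /\ G (f p)]).
  + by split=> //; rewrite pM.
  + split=> [q []//|q r [pq Gq] [pr Gr] neq].
    by apply/forth => //; apply: Gorth => // /finj => /(_ pq pr).
  + by move=> q Pq; split; [exact: Ppr | apply: PG; exists q].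
Qed.

Section CompletelyPositive.
Variables (R : realType) (H : hilbertType R) (K : findim_subspace H).
Variables (m : nat) (A : 'I_m -> 'End(K)).
Implicit Types (u v : K) (p q X : 'End(K)) (M N : {vspace K}).

Lemma adj_invariantP M :
  adj_invariant A M <-> forall i v, v \in M -> adj (A i) v \in M.
Proof.
split=> [inv i v vM|inv i].
  by move/subvP: (inv i); apply; exact: memv_img.
by apply/subvP => _ /memv_imgP[v vM ->]; exact: inv.
Qed.

Lemma adj_invariantI M N :
  adj_invariant A M -> adj_invariant A N -> adj_invariant A (M :&: N)%VS.
Proof.
move=> /adj_invariantP iM /adj_invariantP iN; apply/adj_invariantP => i v.
by rewrite !memv_cap => /andP[/(iM i) -> /(iN i) ->].
Qed.

(** Induction on dimension: if [M] is not minimal, it properly contains a nonzero invariant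
    subspace, which has smaller dimension. *)
Lemma exists_min_invariant M : adj_invariant A M -> M <> 0%VS ->
  exists2 N, min_invariant A N & (N <= M)%VS.
Proof.
have [d le_d] := ubnP (\dim M); elim: d => // d IH in M le_d *.
move=> iM M0; have [minM|] := pselect (min_invariant A M); first by exists M.
move=> nmin.
have [N [iN N0 NM neq]] : exists N,
    [/\ adj_invariant A N, N <> 0%VS, (N <= M)%VS & N <> M].
  apply: contrapT => none; apply: nmin; split=> // N iN N0 NM.
  by apply: contrapT => neq; apply: none; exists N.
have lt_d : (\dim N < d)%N.
  rewrite -ltnS; apply: leq_trans le_d; rewrite ltnS ltn_neqAle dimvS// andbT.
  by apply/eqP => dE; apply: neq; apply/eqP; rewrite eqEdim NM dE leqnn.
have [N' minN' N'N] := IH N lt_d iN N0.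
by exists N' => //; exact: subv_trans NM.
Qed.

Lemma cp_map_kdot X u v : kdot (cp_map A X u) v =
  \sum_i kdot (X (adj (A i) u)) (adj (A i) v).
Proof.
rewrite /cp_map sum_lfunE kdot_suml; apply: eq_bigr => i _.
by rewrite !comp_lfunE /= adjP.
Qed.

Hypothesis unital : cp_map A \1%VF = \1%VF.

Lemma sum_kdot_adj v : \sum_i kdot (adj (A i) v) (adj (A i) v) = kdot v v.
Proof.
transitivity (kdot (cp_map A \1%VF v) v); last by rewrite unital lfunE.
by rewrite cp_map_kdot; apply: eq_bigr => i _; rewrite lfunE.
Qed.

(* With q = 1 - p, unitality turns p <= Phi p into Phi q <= q, that is
   sum_i |q A_i^* v|^2 <= |q v|^2. *)
Lemma op_le_cp_map p : is_proj p ->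
  op_le p (cp_map A p) <-> adj_invariant A (limg p).
Proof.
move=> pp.
have Phi_q v : kdot (cp_map A p v) v = kdot v v -
    \sum_i kdot (adj (A i) v - p (adj (A i) v)) (adj (A i) v - p (adj (A i) v)).
  rewrite -sum_kdot_adj -sumrB cp_map_kdot; apply: eq_bigr => i _.
  rewrite [kdot (adj (A i) v) (adj (A i) v)](proj_pythagoras _ pp) addrK.
  by rewrite -[RHS](proj_kdot _ _ pp) proj_idem.
split=> [[_ le]|/adj_invariantP inv].
  apply/adj_invariantP => i v; rewrite !mem_limg_proj// => /eqP pv.
  have := le v; rewrite add_lfunE opp_lfunE pv kdotBl Phi_q addrAC subrr sub0r oppr_ge0.
  move=> le0; have : \sum_i kdot (adj (A i) v - p (adj (A i) v))
      (adj (A i) v - p (adj (A i) v)) == 0.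
    by rewrite eq_le le0 sumr_ge0// => j _; exact: kdot_ge0.
  rewrite psumr_eq0 => [/allP/(_ i)|j _]; last exact: kdot_ge0.
  by rewrite mem_index_enum kdot_eq0 subr_eq0 eq_sym => /(_ isT).
split=> [|v].
  apply: adj_unique => u v; rewrite !add_lfunE !opp_lfunE kdotBl kdotBr; congr (_ - _).
    rewrite cp_map_kdot [RHS]kdotC cp_map_kdot rmorph_sum /=.
    by apply: eq_bigr => i _; rewrite proj_kdot// -kdotC.
  exact: proj_kdot.
rewrite add_lfunE opp_lfunE kdotBl Phi_q.
have -> : kdot (p v) v = kdot (p v) (p v).
  by rewrite -(proj_kdot (p v))// proj_idem.
rewrite addrAC subr_ge0 {1}(proj_pythagoras v pp) [X in _ <= X - _]addrC addrK.
rewrite -sum_kdot_adj; apply: ler_sum => i _.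
(* Invariance kills the component of [adj (A i) (p v)] off the range of [p], so only [v - p v]
   contributes; the squared norms of the [adj (A i) (v - p v)] sum to that of [v - p v]. *)
have pv : p (adj (A i) (p v)) = adj (A i) (p v).
  apply/eqP; rewrite -mem_limg_proj//; apply: inv.
  exact: memv_img (memvf _).
have -> : adj (A i) v - p (adj (A i) v) =
    adj (A i) (v - p v) - p (adj (A i) (v - p v)).
  by rewrite (linearB (adj (A i))) (linearB p) /= pv opprB addrA subrK.
by rewrite [leRHS](proj_pythagoras _ pp) lerDr kdot_ge0.
Qed.

Lemma limg_eq0 p : limg p = 0%VS <-> p = 0.
Proof.
split=> [p0|->]; last by apply/eqP; rewrite -subv0; apply/subvP => _
  /memv_imgP[v _ ->]; rewrite lfunE /= mem0v.
apply/lfunP => v; apply/eqP; rewrite lfunE /= -memv0 -p0.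
exact: memv_img (memvf _).
Qed.

(** Passing to ranges turns the order of projections into inclusion and [p <= Phi p] into
    invariance, and every subspace of [K] is the range of a projection. *)
Lemma min_projP p :
  min_proj (cp_map A) p <-> is_proj p /\ min_invariant A (limg p).
Proof.
split=> [[pp p0 /(op_le_cp_map pp) ip minp]|[pp [ip p0 minp]]].
  split=> //; split=> // [/limg_eq0//|N iN N0 Np].
  have [q pq qN] := exists_proj N; subst N.
  rewrite (minp q) //; [by move=> q0; apply: N0; apply/limg_eq0 | |].
    exact/op_le_proj.
  exact/op_le_cp_map.
split=> //; [by move/limg_eq0 | exact/op_le_cp_map |].
move=> q pq q0 /(op_le_proj pp pq) qp /(op_le_cp_map pq) iq.
apply: proj_unique => //; apply: minp => //.
by move/limg_eq0.
Qed.

Lemma max_orth_invariant_families (F : set {vspace K}) :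
  max_orth_family (min_invariant A) (@orth_subspaces R H K) F <->
  exists2 P : set 'End(K),
    max_orth_family (min_proj (cp_map A)) (@orth_projs R H K) P &
    F = [set limg p | p in P].
Proof.
apply: max_orth_family_image.
- by move=> p /min_projP[].
- move=> M minM; have [p pp pM] := exists_proj M.
  by exists p => //; apply/min_projP; rewrite pM.
- by move=> p q /min_projP[pp _] /min_projP[pq _]; exact: proj_unique.
- by move=> p q /min_projP[pp _] /min_projP[pq _]; exact: orth_projsP.
Qed.

End CompletelyPositive.

(** Invariance of [M] amounts to [p <= Phi p] for the projection [p] onto [M], a condition in which
    only the map [Phi] occurs. *)
Lemma min_invariant_cp_map (R : realType) (H : hilbertType R)
    (K : findim_subspace H) (m k : nat)
    (A : 'I_m -> 'End(K)) (B : 'I_k -> 'End(K)) :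
  cp_map A \1%VF = \1%VF -> (forall X, cp_map B X = cp_map A X) ->
  min_invariant B = min_invariant A.
Proof.
move=> unitalA BA; have unitalB : cp_map B \1%VF = \1%VF by rewrite BA.
have inv M : adj_invariant B M <-> adj_invariant A M.
  have [p pp <-] := exists_proj M.
  by rewrite -(op_le_cp_map unitalA pp) -(op_le_cp_map unitalB pp) BA.
apply/funext => M; apply/propext.
by split=> -[/inv iM M0 minM]; split=> // N /inv; exact: minM.
Qed.

(** * Closures and intersections of subspaces *)

Section SubspaceClosure.
Variables (R : realType) (H : hilbertType R).
Implicit Types M : set H.

Lemma closure_subspace M : is_subspace M -> is_subspace (closure M).
Proof.
move=> [M0 ML]; split=> [|c x y /closureP Mx /closureP My].
  exact: subset_closure.
apply/closureP => e e0; have e20 : 0 < e / 2 by rewrite divr_gt0.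
(* The added 1 allows division by [k] when [c = 0]. *)
pose k := complex.Re `|c| + 1.
have c0 : 0 <= complex.Re `|c| by rewrite -ler0c -ge0_Re.
have k0 : 0 < k by rewrite ltr_wpDl.
have [x' Mx' xx'] := Mx (e / 2 / k) (divr_gt0 e20 k0).
have [y' My' yy'] := My _ e20.
exists (c *: x' + y'); first exact: ML.
rewrite opprD addrACA -scalerBr (le_lt_trans (nrmD _ _))// nrmZ.
rewrite [ltRHS](splitr e) ltr_leD// ?ltW//.
rewrite (@le_lt_trans _ _ (k * nrm (x - x')))//.
  by rewrite ler_wpM2r ?nrm_ge0// lerDl.
by rewrite mulrC -ltr_pdivlMr.
Qed.

Lemma closure_stable (f : {linear H -> H}) M : continuous f ->
  (forall x, M x -> M (f x)) -> forall x, closure M x -> closure M (f x).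
Proof.
move=> fc fM x /closureP clx; apply/closureP => e e0.
have [d d0 fd] := linear_continuous_nrm fc e0.
by have [y My xy] := clx d d0; exists (f y); [exact: fM | exact: fd].
Qed.

Lemma orthocompl_subspace M : is_subspace (orthocompl M).
Proof.
split=> [y _|c x y xM yM z Mz]; first exact: hdot0l.
by rewrite hdotDl hdotZl xM// yM// mulr0 addr0.
Qed.

(** This property holds for closed subspaces by completeness and for finite-dimensional ones by
    [orthproj], and it passes to orthogonal complements. *)
Definition has_projections M :=
  forall x, exists m, M m /\ forall y, M y -> hdot (x - m) y = 0.

Lemma orthocompl_projections M :
  has_projections M -> has_projections (orthocompl M).
Proof.
move=> pM x; have [m [Mm ort]] := pM x; exists (x - m); split=> // y My.
by rewrite opprB addrC subrK; apply: hdot_eq0C; apply: My.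
Qed.

Lemma incl_subspace (K : findim_subspace H) : is_subspace (range (incl K)).
Proof.
split=> [|c _ _ [u _ <-] [v _ <-]]; first by exists 0 => //; rewrite linear0.
by exists (c *: u + v) => //; rewrite linearP.
Qed.

Lemma incl_projections (K : findim_subspace H) : has_projections (range (incl K)).
Proof.
move=> x; exists (incl K (orthproj K x)); split; first by exists (orthproj K x).
by move=> _ [v _ <-]; exact: orthproj_orth.
Qed.

(* M /\ K as the kernel of the Gram map against the components orthogonal to M
   of a basis of K. *)
Lemma intersection_as_kernel (K : findim_subspace H) M : is_subspace M ->
  has_projections M ->
  exists m (g : 'I_m -> H), (forall i, orthocompl M (g i)) /\
    forall u : K, u \in lker (gram K g) <-> M (incl K u).
Proof.
move=> [M0 ML] /choice [P PM]; exists (\dim {: K}).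
pose b i : H := incl K (vbasis fullv)`_i.
exists (fun i => b i - P (b i)); split=> [i y My|u].
  by have [_] := PM (b i); apply.
rewrite memv_ker; split=> [/eqP gu|Mu].
  suff : incl K u - P (incl K u) = 0.
    by move/eqP; rewrite subr_eq0 => /eqP ->; case: (PM (incl K u)).
  (* Let [z = u - P u]. Then [<z, z> = <z, u>], and [u] is expanded in the basis: [gu] gives
     [<z, b i> = <z, P (b i)>], which is 0. *)
  have [MPu ortu] := PM (incl K u).
  apply/eqP; rewrite -hdot_eq0 hdotBr (ortu _ MPu) subr0.
  rewrite {3}(coord_vbasis (memvf u)) linear_sum hdot_sumr big1// => i _.
  rewrite linearZ hdotZr; have [MPb ortb] := PM (b i).
  suff -> : hdot (incl K u - P (incl K u)) (b i) = 0 by rewrite mulr0.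
  have := congr1 (fun r : 'rV_ _ => r 0 i) gu.
  rewrite gramE mxE hdotBr => /eqP; rewrite subr_eq0 => /eqP uE.
  have PuE : hdot (P (incl K u)) (b i) = hdot (P (incl K u)) (P (b i)).
    by apply/eqP; rewrite -subr_eq0 -hdotBr (hdot_eq0C (ortb _ MPu)).
  by rewrite hdotBl uE PuE -hdotBl ortu.
apply/eqP/rowP => i; rewrite gramE mxE; apply: hdot_eq0C.
by have [_] := PM (b i); apply.
Qed.

End SubspaceClosure.

(** * Levels generated by a Cuntz family *)

Section CuntzFamily.
Variables (R : realType) (H : hilbertType R) (n : nat).
Variables (S T : 'I_n -> {linear H -> H}).
Hypothesis ST : forall i x y, hdot (S i x) y = hdot x (T i y).
Hypothesis TS : forall i j x, T i (S j x) = if i == j then x else 0.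
Hypothesis sumST : forall x, \sum_i S i (T i x) = x.
Implicit Types (M N : set H) (x y : H).

Lemma sum_nrm_T x : \sum_i nrm (T i x) ^+ 2 = nrm x ^+ 2.
Proof.
apply: (@complexI R); rewrite -hdot_nrm -{2}(sumST x) hdot_suml rmorph_sum /=.
by apply: eq_bigr => i _; rewrite -hdot_nrm ST.
Qed.

Lemma T_sumS (y : 'I_n -> H) i : T i (\sum_j S j (y j)) = y i.
Proof.
rewrite linear_sum (bigD1 i) //= TS eqxx big1 ?addr0// => j ji.
by rewrite TS eq_sym (negbTE ji).
Qed.

(** The sums of [S_w u_w] over all words [w] of length [k], with each [u_w] in [N], grouped by first
    letter. *)
Fixpoint level N (k : nat) : set H :=
  if k is k'.+1 then
    [set \sum_i S i (y i) | y in [set y : 'I_n -> H | forall i, level N k' (y i)]]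
  else N.

Definition generated N : set H := [set x | exists k, level N k x].

Section Generated.
Variable N : set H.
Hypothesis Nsub : is_subspace N.
Hypothesis NT : forall i x, N x -> N (T i x).

(** [T i] strips the first letter and leaves [y i], one level lower; writing [y i] as the sum of the
    [S j (T j (y i))] lifts it back, by induction. *)
Lemma level_T k i x : level N k x -> level N k (T i x).
Proof.
elim: k i x => [|k IH] i x; first exact: NT.
move=> [y Ny <-]; rewrite T_sumS.
rewrite -(sumST (y i)); exists (fun j => T j (y i)) => // j.
apply: IH; apply: Ny.
Qed.

Lemma level_succ k x : level N k x -> level N k.+1 x.
Proof.
move=> Nx; rewrite -(sumST x); exists (fun i => T i x) => // i.
exact: level_T.
Qed.

Lemma level_le k l x : (k <= l)%N -> level N k x -> level N l x.
Proof.
move=> /subnKC <-; elim: (l - k)%N => [|d IH]; first by rewrite addn0.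
by rewrite addnS => /IH; exact: level_succ.
Qed.

Lemma level_subspace k : is_subspace (level N k).
Proof.
elim: k => //= k [k0 kL]; split.
  by exists (fun=> 0) => //; rewrite big1// => i _; rewrite linear0.
move=> c _ _ [x Nx <-] [y Ny <-]; exists (fun i => c *: x i + y i).
  by move=> i; exact: kL.
rewrite scaler_sumr -big_split; apply: eq_bigr => i _.
by rewrite linearP.
Qed.

Lemma generated_subspace : is_subspace (generated N).
Proof.
split=> [|c x y [k Nx] [l Ny]]; first by exists 0%N; exact: (proj1 Nsub).
exists (maxn k l); apply: (proj2 (level_subspace _)).
  exact: level_le (leq_maxl _ _) Nx.
exact: level_le (leq_maxr _ _) Ny.
Qed.

Lemma generated_T i x : generated N x -> generated N (T i x).
Proof. by move=> [k Nx]; exists k; exact: level_T. Qed.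

Lemma generated_S i x : generated N x -> generated N (S i x).
Proof.
move=> [k Nx]; exists k.+1; exists (fun j => if j == i then x else 0).
  by move=> j; case: ifP => // _; exact: (proj1 (level_subspace _)).
rewrite (bigD1 i) //= eqxx big1 ?addr0// => j /negbTE ->.
by rewrite linear0.
Qed.

Lemma closure_generated_full :
  closed_span (\bigcup_(w in [set w : seq 'I_n | w <> [::]])
    [set foldr (fun i x => S i x) x w | x in N]) = setT ->
  closure (generated N) = setT.
Proof.
move=> Nfull; apply/seteqP; split=> // x _.
have : [set: H] x by []. rewrite -Nfull; apply; split.
  split; last exact: closed_closure.
  exact: closure_subspace generated_subspace.
move=> _ [w _ [u Nu <-]]; apply: subset_closure.
by elim: w => [|i w IH] /=; [exists 0%N | exact: generated_S].
Qed.

End Generated.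

(* On the levels, y is controlled by its distance to M as soon as it is on N:
   apply the bound to each T i x and y i, and sum over i. *)
Lemma level_bound N M (C : R) : (forall i x, M x -> M (T i x)) ->
  (forall u x, N u -> M x -> nrm u ^+ 2 <= C * nrm (x - u) ^+ 2) ->
  forall k y x, level N k y -> M x -> nrm y ^+ 2 <= C * nrm (x - y) ^+ 2.
Proof.
move=> MT NM; elim=> [|k IH] y x; first exact: NM.
move=> [z Nz <-] Mx; rewrite -sum_nrm_T -(sum_nrm_T (x - _)) mulr_sumr.
apply: ler_sum => i _; rewrite linearB T_sumS.
by apply: IH; [exact: Nz | exact: MT].
Qed.

Lemma invariant_subspace_meets (K : findim_subspace H) M x :
  is_subspace M -> (forall i x, M x -> M (T i x)) -> has_projections M ->
  M x -> x <> 0 -> closure (generated (range (incl K))) x ->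
  exists2 u : K, u <> 0 & M (incl K u).
Proof.
move=> Msub MT pM Mx x0 /closureP clx; apply: contrapT => none.
have [m [g [gM kerg]]] := intersection_as_kernel K Msub pM.
have ker0 : lker (gram K g) == 0%VS.
  rewrite -subv0; apply/subvP => u /kerg Mu; rewrite memv0; apply/eqP.
  by apply: contrapT => u0; apply: none; exists u.
have [w wE] := gram_reconstruction ker0.
(* For [y] in [M], [g i] is orthogonal to [y], so the coefficients of [u] in the family [w] are
   inner products of [u - y] with [g i]; Cauchy-Schwarz then bounds [|u|] by [C |y - u|]. *)
pose C := \sum_i nrm (g i) * nrm (incl K (w i)).
have C0 : 0 <= C by apply: sumr_ge0 => i _; rewrite mulr_ge0 ?nrm_ge0.
have bound u y : range (incl K) u -> M y -> nrm u ^+ 2 <= C ^+ 2 * nrm (y - u) ^+ 2.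
  move=> [{}u _ <-] My; rewrite -exprMn ler_sqr ?nnegrE ?mulr_ge0 ?nrm_ge0//.
  rewrite {1}(wE u) linear_sum mulr_suml.
  elim/big_rec2: _ => [|i a b _ le]; first by rewrite nrm0.
  rewrite (le_trans (nrmD _ _))// lerD// linearZ nrmZ mulrAC.
  rewrite ler_wpM2r ?nrm_ge0//.
  have -> : hdot (incl K u) (g i) = hdot (incl K u - y) (g i).
    by rewrite hdotBl (hdot_eq0C (gM i _ My)) subr0.
  by rewrite (le_trans (cauchy_schwarz _ _))// mulrC nrm_distC.
have xpos : 0 < nrm x by rewrite lt_neqAle nrm_ge0 andbT eq_sym nrm_eq0; apply/eqP.
have C1 : 0 < 1 + C by rewrite ltr_pwDl.
(* With this tolerance, [|y| <= C |x - y|] gives [|x| <= (1 + C) |x - y| < |x|], a contradiction. *)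
have [y [k ky] xy] := clx (nrm x / (1 + C)) (divr_gt0 xpos C1).
have := level_bound MT bound ky Mx.
rewrite -exprMn ler_sqr ?nnegrE ?mulr_ge0 ?nrm_ge0// => ley.
move: xy; rewrite ltr_pdivlMr// => xy.
have := nrm_distD y x 0; rewrite !subr0; move: ley xy; lra.
Qed.

End CuntzFamily.

(** * C*-algebras and continuity of representations *)

Section CStarTheory.
Variables (R : realType) (A : cstarAlgType R).
Implicit Types a b c d h : A.

Lemma cmulBl a b d : cmul (a - b) d = cmul a d - cmul b d.
Proof. by rewrite addrC -scaleN1r cmul_linearl scaleN1r addrC. Qed.

Lemma cmulBr a b d : cmul d (a - b) = cmul d a - cmul d b.
Proof. by rewrite addrC -scaleN1r cmul_linearr scaleN1r addrC. Qed.

Lemma starB a b : star (a - b) = star a - star b.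
Proof.
by rewrite addrC -scaleN1r star_semilinear rmorphN1 scaleN1r addrC.
Qed.

Lemma starD a b : star (a + b) = star a + star b.
Proof. by rewrite -[a]scale1r star_semilinear rmorph1 !scale1r. Qed.

Lemma star0 : star 0 = 0 :> A.
Proof. by have := starB 0 0; rewrite !subrr. Qed.

Lemma starZ (c : R[i]) a : star (c *: a) = Num.conj c *: star a.
Proof. by rewrite -[c *: a]addr0 star_semilinear star0 addr0. Qed.

Lemma star_cone : star cone = cone :> A.
Proof. by have := starM (star (cone : A)) cone; rewrite cmul1r !starK cmul1r => <-. Qed.

Lemma nrm_cmul a b : nrm (cmul a b) <= nrm a * nrm b.
Proof.
by rewrite -lecR (rmorphM (real_complex R)) /= -!nrmE cstar_normM.
Qed.

Lemma nrm_cstar a : nrm (cmul (star a) a) = nrm a ^+ 2.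
Proof.
apply: (@complexI R).
by rewrite (rmorphXn (real_complex R)) /= -!nrmE cstar_norm.
Qed.

(** The C*-identity gives [|c|^2 <= |star c| |c|]; the other inequality follows since [star] is an
    involution. *)
Lemma nrm_star a : nrm (star a) = nrm a.
Proof.
have le c : nrm c <= nrm (star c).
  have [->|c0] := eqVneq (nrm c) 0; first exact: nrm_ge0.
  rewrite -(@ler_pM2r _ (nrm c)) ?lt_neqAle ?nrm_ge0 ?andbT 1?eq_sym//.
  by rewrite -expr2 -nrm_cstar nrm_cmul.
by apply/eqP; rewrite eq_le le andbT -{2}(starK a) le.
Qed.

(* b = 1 - c, where c is the fixed point of the contraction
   c |-> (h + c^2) / 2 of the ball of radius |h|. *)
Lemma sqrt_one_sub h : star h = h -> nrm h < 1 ->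
  exists2 b, star b = b & cmul b b = cone - h.
Proof.
move=> hh h1; pose r := nrm h; pose k : R[i] := (2^-1 : R)%:C.
pose F c := k *: (h + cmul c c).
pose D := [set c : A | star c = c /\ nrm c <= r].
have r0 : 0 <= r by exact: nrm_ge0.
have kx (x : A) : k *: x + k *: x = x.
  rewrite -scalerDl -(rmorphD (real_complex R)) /=.
  have -> : 2^-1 + 2^-1 = 1 :> R by lra.
  by rewrite scale1r.
have nk (x : A) : nrm (k *: x) = 2^-1 * nrm x.
  by rewrite nrmZr ger0_norm// invr_ge0.
have kC : Num.conj k = k by apply: conj_Creal; apply/complex_realP; exists 2^-1.
have [|||||c [cs cr] cF] := @contraction_fixpoint R A D F r 0.
- by rewrite r0 h1.
- apply/closedP => x Dx; split.
    apply/eqP; rewrite -subr_eq0 -nrm_eq0 eq_le nrm_ge0 andbT.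
    apply/ler_addgt0Pr => e e0; rewrite add0r.
    have [y [ys yr] xy] := Dx (e / 2) (divr_gt0 e0 (ltr0n _ 2)).
    rewrite (le_trans (nrm_distD y _ _))// -{1}ys -starB nrm_star.
    by rewrite (nrm_distC y) [leRHS](splitr e) lerD// ltW.
  apply/ler_addgt0Pr => e e0; have [y [ys yr] xy] := Dx e e0.
  have := nrm_distD y x 0; rewrite !subr0 => /le_trans; apply.
  by rewrite addrC lerD// ltW.
- by split; [rewrite star0 | rewrite nrm0].
- move=> x [xs xr]; split.
    by rewrite /F starZ kC starD starM hh xs.
  rewrite /F nk (@le_trans _ _ (2^-1 * (r + r * r)))//.
    rewrite ler_wpM2l ?invr_ge0// (le_trans (nrmD _ _))// lerD//.
    by rewrite (le_trans (nrm_cmul _ _))// ler_pM ?nrm_ge0.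
  have : r * r <= r by rewrite ler_piMl// ltW.
  lra.
- move=> x y [xs xr] [ys yr]; rewrite /F -scalerBr nk opprD addrACA subrr add0r.
  (* The difference of squares is split without commuting factors; each term is at most [r |x - y|],
     and the factor 1/2 in [F] leaves the ratio [r]. *)
  have -> : cmul x x - cmul y y = cmul x (x - y) + cmul (x - y) y.
    by rewrite cmulBr cmulBl addrA subrK.
  have : nrm (cmul x (x - y) + cmul (x - y) y) <= r * nrm (x - y) + nrm (x - y) * r.
    rewrite (le_trans (nrmD _ _))// lerD// (le_trans (nrm_cmul _ _))//.
      by rewrite ler_wpM2r ?nrm_ge0.
    by rewrite ler_wpM2l ?nrm_ge0.
  lra.
exists (cone - c); first by rewrite starB star_cone cs.
rewrite cmulBl !cmulBr !cmul1l cmul1r.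
(* The fixed point equation is [2 c = h + c^2], whence [(1 - c)^2 = 1 - h]. *)
have -> : h = c + c - cmul c c by rewrite -{1 2}cF /F kx addrK.
rewrite !opprB opprD !addrA; congr (_ - _); exact: addrAC.
Qed.

End CStarTheory.

(** * Norm bounds and reducing subspaces of representations *)

Section RepresentationTheory.
Variables (R : realType) (A : cstarAlgType R) (H : hilbertType R).
Variable pi : representation A H.
Implicit Types (a b : A) (x y : H).

Lemma repB a b x : pi (a - b) x = pi a x - pi b x.
Proof. by rewrite addrC -scaleN1r rep_semilinear scaleN1r addrC. Qed.

Lemma rep0 x : pi 0 x = 0.
Proof. by rewrite -(subrr 0) repB subrr. Qed.

Lemma repZ c a x : pi (c *: a) x = c *: pi a x.
Proof. by rewrite -[c *: a]addr0 rep_semilinear rep0 addr0. Qed.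

Lemma repD a b x : pi (a + b) x = pi a x + pi b x.
Proof. by rewrite -[a]scale1r rep_semilinear !scale1r. Qed.

Lemma rep_sum I (r : seq I) (F : I -> A) x :
  pi (\sum_(i <- r) F i) x = \sum_(i <- r) pi (F i) x.
Proof. by elim/big_rec2: _ => [|i a y _ <-]; [exact: rep0 | exact: repD]. Qed.

(* Writing 1 - a^* a = b^2 with b self-adjoint, |x|^2 - |pi a x|^2 = |pi b x|^2. *)
Lemma rep_contractive a x : nrm a < 1 -> nrm (pi a x) <= nrm x.
Proof.
move=> a1; have [||b bs bb] := @sqrt_one_sub R A (cmul (star a) a).
- by rewrite starM starK.
- by rewrite nrm_cstar expr_lt1// nrm_ge0.
rewrite -ler_sqr ?nnegrE ?nrm_ge0// -lecR -!hdot_nrm.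
rewrite rep_star -repM -subr_ge0 -hdotBr -[X in X - _](rep1 pi) -repB -bb repM.
by rewrite -{1}bs -rep_star hdot_ge0.
Qed.

Lemma rep_bound a x (t : R) : nrm a < t -> nrm (pi a x) <= t * nrm x.
Proof.
move=> at_; have t0 : 0 < t by exact: le_lt_trans (nrm_ge0 a) at_.
have := @rep_contractive (t^-1%:C *: a) x.
rewrite repZ !nrmZr gtr0_norm ?invr_gt0// ltr_pdivrMl// mulr1.
by rewrite ler_pdivrMl//; apply.
Qed.

Lemma rep_closure (M : set H) (B : set A) x : closed M ->
  (forall b, B b -> M (pi b x)) -> forall a, closure B a -> M (pi a x).
Proof.
move=> /closedP cM BM a /closureP clB; apply: cM => e e0.
have x1 : 0 < nrm x + 1 by rewrite ltr_wpDl ?nrm_ge0.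
have [b Bb ab] := clB _ (divr_gt0 e0 x1).
exists (pi b x); first exact: BM.
rewrite -repB (le_lt_trans (rep_bound _ ab))// mulrAC ltr_pdivrMr//.
by rewrite ltr_pM2l// ltrDl.
Qed.

(** The elements that preserve [M] together with their adjoints form a C*-subalgebra containing [G],
    hence everything. The orthogonal complement is then preserved because adjoints preserve [M]. *)
Lemma reducing_of_generators (G : set A) (M : set H) :
  smallest (@cstar_subalgebra R A) G = setT ->
  is_subspace M -> closed M ->
  (forall a x, G a -> M x -> M (pi a x) /\ M (pi (star a) x)) ->
  reducing pi M.
Proof.
move=> gen [M0 ML] cM GM.
pose B := [set a | forall x, M x -> M (pi a x) /\ M (pi (star a) x)].
have Ball a : B a.
  have : [set: A] a by []. rewrite -gen; apply; split.
    split=> [x Mx|c b d Bb Bd x Mx|b d Bb Bd x Mx|b Bb x Mx|b clB x Mx].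
    - by rewrite star_cone !rep1.
    - have [[Mb Mb'] [Md Md']] := (Bb x Mx, Bd x Mx).
      by rewrite star_semilinear !rep_semilinear; split; exact: ML.
    - rewrite starM !repM; split.
        by apply: (proj1 (Bb _ _)); exact: (proj1 (Bd _ _)).
      by apply: (proj2 (Bd _ _)); exact: (proj2 (Bb _ _)).
    - by rewrite starK; case: (Bb x Mx).
    split; first by apply: (rep_closure cM _ clB) => d /(_ x Mx)[].
    (* As [star] is isometric, [star b] is a limit of adjoints of elements of [B]. *)
    apply: (@rep_closure M [set d | M (pi d x)]) => //.
    apply/closureP => e e0; move/closureP : clB => /(_ e e0)[d Bd bd].
    by exists (star d); [case: (Bd x Mx) | rewrite -starB nrm_star].
  by move=> b Gb x Mx; exact: GM.
move=> a; split=> _ [x Mx <-]; first by case: (Ball a x Mx).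
move=> y My; rewrite rep_star; apply: Mx.
by case: (Ball a y My).
Qed.

End RepresentationTheory.

(** * Minimal invariant subspaces and irreducibility *)

Section CuntzRepresentation.
Variables (R : realType) (n : nat) (On : cstarAlgType R) (s : 'I_n -> On).
Variables (H : hilbertType R) (pi : representation On H).
Variable K : findim_subspace H.
Hypothesis rel : cuntz_relations s.
Hypothesis gen : smallest (@cstar_subalgebra R On) (range s) = setT.
Hypothesis Kinv :
  forall i, pi (star (s i)) @` range (incl K) `<=` range (incl K).
Hypothesis Kgen : closed_span
  (\bigcup_(w in [set w : seq 'I_n | w <> [::]])
     [set foldr (fun i x => pi (s i) x) x w | x in range (incl K)]) = setT.

Let S i := pi (s i).
Let T i := pi (star (s i)).
Let A i := compression K (pi (s i)).

Let ST i x y : hdot (S i x) y = hdot x (T i y).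
Proof. exact: rep_star. Qed.

Let TS i j x : T i (S j x) = if i == j then x else 0.
Proof.
rewrite /T /S -repM (proj1 rel); case: ifP => _; [exact: rep1 | exact: rep0].
Qed.

Let sumST x : \sum_i S i (T i x) = x.
Proof.
rewrite -[RHS](rep1 pi) -(proj2 rel) rep_sum.
by apply: eq_bigr => i _; rewrite repM.
Qed.

Let T_range i x : range (incl K) x -> range (incl K) (T i x).
Proof. by move=> Kx; apply: (Kinv (i := i)); exists x. Qed.

Let K_full : closure (generated S (range (incl K))) = setT.
Proof.
exact: (closure_generated_full TS sumST (incl_subspace K) T_range Kgen).
Qed.

(** Both sides have the same inner products with [K], and by invariance of [K] the right side
    already lies in [K]. *)
Lemma incl_adj_compression i v : incl K (adj (A i) v) = T i (incl K v).
Proof.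
have /(T_range i)[w _ wE] : range (incl K) (incl K v) by exists v.
rewrite -wE; congr (incl K _); apply: kdot_ext => u.
rewrite adj_adjP compressionE /kdot wE /T rep_star starK.
apply: esym; apply/eqP; rewrite -subr_eq0 -hdotBr; apply/eqP/hdot_eq0C.
exact: orthproj_orth.
Qed.

Lemma compression_unital : cp_map A \1%VF = \1%VF.
Proof.
apply/lfunP => u; apply: kdot_ext => v; rewrite cp_map_kdot lfunE /=.
rewrite [RHS]/kdot -(sumST (incl K u)) hdot_suml; apply: eq_bigr => i _.
by rewrite lfunE /= ST /kdot !incl_adj_compression.
Qed.

(** The intersection of [M] with [K] is a Gram kernel, hence a [{vspace K}]; it is invariant because
    [adj (A i)] restricts [T i], and nonzero by [invariant_subspace_meets]. *)
Lemma meets_min_invariant (M : set H) x : is_subspace M ->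
  (forall i y, M y -> M (T i y)) -> has_projections M -> M x -> x <> 0 ->
  exists2 N, min_invariant A N & forall u, u \in N -> M (incl K u).
Proof.
move=> Msub MT pM Mx x0.
have [m [g [_ kerg]]] := intersection_as_kernel K Msub pM.
have [||N minN NU] := @exists_min_invariant _ _ _ _ A (lker (gram K g)).
- apply/adj_invariantP => i v /kerg Mv; apply/kerg.
  by rewrite incl_adj_compression; exact: MT.
- have clx : closure (generated S (range (incl K))) x by rewrite K_full.
  have [u u0 /kerg uU U0] :=
    invariant_subspace_meets ST TS sumST Msub MT pM Mx x0 clx.
  by apply: u0; apply/eqP; rewrite -memv0 -U0.
by exists N => // u uN; apply/kerg; move/subvP : NU; apply.
Qed.

Lemma irreducible_of_unique_min_proj :
  (exists! p, min_proj (cp_map A) p) -> irreducible_rep pi.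
Proof.
move=> [p [minp uniq]] M Msub cM red.
have pM : has_projections M.
  by move=> x; have [m Mm ort] := orthogonal_projection x Msub cM; exists m.
apply: contrapT => /not_orP[M0 MT].
have [x [Mx x0]] : exists x, M x /\ x <> 0.
  apply: contrapT => none; apply: M0; apply/seteqP; split=> [x Mx|_ ->].
    by apply: contrapT => x0; apply: none; exists x.
  exact: (proj1 Msub).
have [y [My y0]] : exists y, orthocompl M y /\ y <> 0.
  apply: contrapT => none; apply: MT; apply/seteqP; split=> // x' _.
  have [m [Mm ort]] := pM x'; apply: contrapT => Mx'; apply: none.
  by exists (x' - m); split=> // /eqP; rewrite subr_eq0 => /eqP xm; apply: Mx'; rewrite xm.
have stable i z : M z -> M (T i z).
  by move=> Mz; apply: (proj1 (red (star (s i)))); exists z.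
have stable' i z : orthocompl M z -> orthocompl M (T i z).
  by move=> Mz; apply: (proj2 (red (star (s i)))); exists z.
have unit := compression_unital.
have [N minN NM] := meets_min_invariant Msub stable pM Mx x0.
have [N' minN' N'M] := meets_min_invariant (orthocompl_subspace M) stable'
  (orthocompl_projections pM) My y0.
have pE L : min_invariant A L -> limg p = L.
  move=> minL; have [q pq qL] := exists_proj L.
  by rewrite (uniq q)//; apply/(min_projP unit); rewrite qL.
(* Both are the range of the unique [p], so a vector of [N] lies in [M] and in its orthogonal
   complement. *)
have NN' : N = N' by rewrite -(pE _ minN) (pE _ minN').
have [_ N0 _] := minN; apply: N0; apply/eqP; rewrite -subv0.
apply/subvP => u uN; rewrite memv0 -incl_eq0 -hdot_eq0; apply/eqP.
by apply: (N'M u); [rewrite -NN' | exact: NM].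
Qed.

Lemma unique_min_proj_of_irreducible : (exists x : H, x <> 0) ->
  irreducible_rep pi -> exists! p, min_proj (cp_map A) p.
Proof.
move=> [x x0] irr; have unit := compression_unital.
have Hsub : is_subspace (@setT H) by [].
have Hproj : has_projections (@setT H).
  by move=> y; exists y; split=> // z _; rewrite subrr hdot0l.
(* Existence: the whole space serves as [M], and [x] as its nonzero vector. *)
have [//|N minN _] := meets_min_invariant Hsub _ Hproj I x0.
have [p pp pN] := exists_proj N.
exists p; split=> [|q /(min_projP unit)[pq minq]].
  by apply/(min_projP unit); rewrite pN.
apply: proj_unique => //; rewrite pN.
have [iN N0 Nmin] := minN; have [iM M0 Mmin] := minq.
set M := limg q in iM M0 Mmin *.
pose Nset := range (incl (sub_findim N)); pose Mset := range (incl (sub_findim M)).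
have stable L : adj_invariant A L ->
    forall i y, range (incl (sub_findim L)) y -> range (incl (sub_findim L)) (T i y).
  move=> /adj_invariantP iL i _ [v _ <-] /=.
  rewrite -incl_adj_compression; have vL := iL i _ (subvsP v).
  by exists (vsproj L (adj (A i) (vsval v))) => //=; rewrite vsprojK.
have Nsub := incl_subspace (sub_findim N).
pose G := closure (generated S Nset).
have Gsub : is_subspace G.
  by apply: closure_subspace; exact: (generated_subspace TS sumST Nsub (stable _ iN)).
have cG : closed G by exact: closed_closure.
have nonzero (L : {vspace K}) : L <> 0%VS -> exists2 u, u \in L & u <> 0.
  move=> L0; exists (vpick L); first exact: memv_pick.
  by apply/eqP; rewrite vpick0; apply/eqP.
(* [G] reduces [pi] and contains [N] as its level 0, so irreducibility leaves only the whole
   space. *)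
have GT : G = setT.
  case: (irr G) => // [|G0].
    apply: (reducing_of_generators gen Gsub cG) => _ y [i _ <-] Gy; split.
      apply: closure_stable Gy; first exact: rep_bounded.
      exact: generated_S.
    apply: closure_stable Gy; first exact: rep_bounded.
    exact: (generated_T TS sumST (stable _ iN)).
  have [u uN u0] := nonzero N N0; exfalso; apply: u0; apply/eqP.
  rewrite -(incl_eq0 (K := K)); apply/eqP.
  have : G (incl K u).
    apply: subset_closure; exists 0%N; exists (vsproj N u) => //=.
    by rewrite vsprojK.
  by rewrite G0.
have [v vM v0] := nonzero M M0.
(* Here [N] generates [H] in place of [K], so the invariant subspace [M] meets it. *)
have [||||||u u0 [w _ wE]] := @invariant_subspace_meets _ _ _ S T ST TS sumST
    (sub_findim N) Mset (incl K v).
- exact: incl_subspace.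
- exact: stable.
- exact: incl_projections.
- by exists (vsproj M v) => //=; rewrite vsprojK.
- by apply/eqP; rewrite incl_eq0; apply/eqP.
- by rewrite -/G GT.
have uM : vsval u \in M.
  have /incl_inj <- : incl K (vsval w) = incl K (vsval u) by [].
  exact: subvsP.
have NM0 : (N :&: M)%VS <> 0%VS.
  move=> NM; apply: u0; apply/val_inj/eqP; rewrite /= -memv0 -NM memv_cap uM.
  by rewrite subvsP.
rewrite -(Nmin _ (adj_invariantI iN iM) NM0 (capvSl _ _)).
exact: (Mmin _ (adj_invariantI iN iM) NM0 (capvSr _ _)).
Qed.

End CuntzRepresentation.

Theorem mainTheorem3 (R : realType) (n : nat) (On : cstarAlgType R)
    (s : 'I_n -> On) (H : hilbertType R) (pi : representation On H)
    (K : findim_subspace H)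
    (hn : (2 <= n)%N)
    (hOn : is_cuntz_algebra s)
    (hKinv : forall i, pi (star (s i)) @` range (incl K) `<=` range (incl K))
    (hKgen : closed_span
       (\bigcup_(w in [set w : seq 'I_n | w <> [::]])
          [set foldr (fun i x => pi (s i) x) x w | x in range (incl K)])
       = setT) :
  let A := fun i : 'I_n => compression K (pi (s i)) in
  let Phi := cp_map A in
  (* (a) *)
  ((forall F : set {vspace K},
      max_orth_family (min_invariant A) (@orth_subspaces R H K) F <->
      exists2 P : set 'End(K),
        max_orth_family (min_proj Phi) (@orth_projs R H K) P &
        F = [set limg p | p in P]) /\
   (* the subspaces in (a) depend only on Phi *)
   (forall (m : nat) (B : 'I_m -> 'End(K)),
      (forall X, cp_map B X = Phi X) ->
      forall F : set {vspace K},
        max_orth_family (min_invariant B) (@orth_subspaces R H K) F <->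
        max_orth_family (min_invariant A) (@orth_subspaces R H K) F)) /\
  (* (b) *)
  ((exists x : H, x <> 0) ->
     (irreducible_rep pi <-> exists! p : 'End(K), min_proj Phi p)).
Proof.
move=> A Phi; have [rel gen _] := hOn.
have unital : cp_map A \1%VF = \1%VF := compression_unital rel hKinv.
split; first split.
- exact: max_orth_invariant_families.
- by move=> m B BA F; rewrite (min_invariant_cp_map unital BA).
- move=> H0; split.
    exact: unique_min_proj_of_irreducible.
  exact: irreducible_of_unique_min_proj.
Qed.
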